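(* Let $n=2$ and let $\Gamma\neq 0$ be a real trilinear (completely symmetric) $2\times2\times2$ tensor, with $a_3=\Gamma^1_{11}$, $a_2=\Gamma^2_{11}=\Gamma^1_{12}$, $a_1=\Gamma^1_{22}=\Gamma^2_{12}$, $a_0=\Gamma^2_{22}$. Then $\Gamma$ is fully decoupleable if and only if $$a_2(a_2-a_0)=a_1(a_3-a_1).$$ Moreover, when this relation holds, the tensors $R=\sigma_\theta\circ\Gamma$ and $S=(\sigma_\psi\mathcal{N})\circ\Gamma$ are in fully decoupled reduced form whenever the angles $\theta,\psi\in[0,2\pi)$ satisfy $$e^{4i\theta}=\frac{(a_0+a_2)+i(a_1+a_3)}{(a_0-3a_2)+i(a_3-3a_1)},\qquad e^{4i\psi}=\frac{(a_3+a_1)+i(a_2+a_0)}{(a_3-3a_1)+i(a_0-3a_2)},$$ and then $$R^2_{22}+iR^1_{11}=e^{-i\theta}\big[(a_0+a_2)+i(a_1+a_3)\big],\qquad S^2_{22}+iS^1_{11}=e^{-i\psi}\big[(a_3+a_1)+i(a_0+a_2)\big].$$ The maps $\sigma_\theta$ for the four such $\theta$ and $\sigma_\psi\mathcal{N}$ for the four such $\psi$ are the only elements $\sigma\in O(2)$ for which $\sigma\circ\Gamma$ is in fully decoupled reduced form.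
   Context: A real $2\times2\times2$ tensor $\Gamma=(\Gamma^i_{jk})$ is trilinear if $\Gamma^i_{jk}=\Gamma^i_{kj}=\Gamma^j_{ik}$ for all $i,j,k$. The group $O(2)$ acts by $(\sigma\circ\Gamma)^i_{jk}=\sum_{i',j',k'}\sigma_{ii'}\sigma_{jj'}\sigma_{kk'}\Gamma^{i'}_{j'k'}$. A tensor $R$ is in fully decoupled reduced form if for each $i$, $R^i_{jk}=0$ for all $(j,k)\ne(i,i)$. $\Gamma$ is fully decoupleable if $\sigma\circ\Gamma$ is in fully decoupled reduced form for some $\sigma\in O(2)$. Notation: $$\sigma_\theta=\begin{pmatrix}\cos\theta&-\sin\theta\\ \sin\theta&\cos\theta\end{pmatrix},\qquad \mathcal{N}=\begin{pmatrix}0&1\\1&0\end{pmatrix}$$ (so $\mathcal{N}(x_1,x_2)=(x_2,x_1)$). In exponents and complex expressions $i=\sqrt{-1}$. *)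

(* Defs.v *)
From mathcomp Require Export all_boot all_order all_algebra.
From mathcomp Require Export all_classical all_reals all_analysis.
From mathcomp Require Export complex.

Set Implicit Arguments.
Unset Strict Implicit.
Unset Printing Implicit Defensive.

Import Order.TTheory GRing.Theory Num.Theory.
Local Open Scope ring_scope.

(* [G i j k] is the coefficient with upper index i and lower indices j, k. *)
Notation tensor R n := {ffun 'I_n -> 'M[R]_n}.

Section Tensors.
Variables (R : realType) (n : nat).

Definition trilinear (G : tensor R n) : Prop :=
  forall i j k, G i j k = G i k j /\ G i j k = G j i k.

Definition tensor_act (s : 'M[R]_n) (G : tensor R n) : tensor R n :=
  [ffun i => \matrix_(j, k)
    \sum_(i' < n) \sum_(j' < n) \sum_(k' < n)
      s i i' * s j j' * s k k' * G i' j' k'].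

Definition orthogonal_mx (s : 'M[R]_n) : Prop := s *m s^T = 1%:M.

Definition fully_decoupled (G : tensor R n) : Prop :=
  forall i j k, (j, k) <> (i, i) -> G i j k = 0.

Definition fully_decoupleable (G : tensor R n) : Prop :=
  exists s : 'M[R]_n, orthogonal_mx s /\ fully_decoupled (tensor_act s G).

End Tensors.

Section Dimension2.
Variable R : realType.

Definition mx2 (a b c d : R) : 'M[R]_2 :=
  \matrix_(i, j) if i == ord0 then (if j == ord0 then a else b)
                 else (if j == ord0 then c else d).

Definition rotation (t : R) : 'M[R]_2 := mx2 (cos t) (- sin t) (sin t) (cos t).

Definition swap_mx : 'M[R]_2 := mx2 0 1 1 0.

(* e^{it} *)
Definition expi (t : R) : R[i] := (cos t +i* sin t)%C.

End Dimension2.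

Arguments swap_mx {R}.

(* The indices 1 and 2 of the two-dimensional setting. *)
Notation ix1 := (ord0 : 'I_2).
Notation ix2 := (ord_max : 'I_2).

(* Main.v *)
(** Split the cubic form of [G] into its trace part [u] and its harmonic part
    [w], read as complex numbers: rotating by [t] multiplies [u] by [e^{-it}]
    and [w] by [e^{3it}], and [G] is fully decoupled iff [u = w].  Hence
    [rotation t] decouples [G] iff [e^{4it} w = u], which is solvable iff
    [|u| = |w|]; up to a factor, [|u|^2 - |w|^2] is the relation between the
    coefficients.  A reflection is a rotation after [swap_mx]. *)
Require Import Defs.
From mathcomp Require Import ring lra.
Import Order.TTheory GRing.Theory Num.Theory.
Local Open Scope classical_set_scope.
Local Open Scope ring_scope.

(** * Angles on the unit circle *)

Section Expi.
Set Implicit Arguments.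
Unset Strict Implicit.
Variable R : realType.
Implicit Types (t : R) (z : R[i]).

Lemma complex_eqP (x y : R[i]) :
  complex.Re x = complex.Re y -> complex.Im x = complex.Im y -> x = y.
Proof. by case: x y => [a b] [c d] /= -> ->. Qed.

Lemma expi0 : expi (0 : R) = 1.
Proof. by rewrite /expi cos0 sin0. Qed.

Lemma expiD (s t : R) : expi (s + t) = expi s * expi t.
Proof. by apply: complex_eqP; rewrite /= ?cosD ?sinD; ring. Qed.

Lemma expiN t : expi (- t) * expi t = 1.
Proof. by rewrite -expiD addNr expi0. Qed.

Lemma expi_mul4 t : expi (4 * t) = expi t ^+ 4.
Proof.
have -> : 4 * t = t + (t + (t + t)) by ring.
by rewrite !expiD !exprS expr0 mulr1.
Qed.

Lemma norm_expi t : `|expi t| = 1.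
Proof. by rewrite normc_def /= cos2Dsin2 sqrtr1. Qed.

Lemma expi_add2pi t (k : nat) : expi (t + 2 * pi * k%:R) = expi t.
Proof.
elim: k => [|k IHk]; first by rewrite mulr0 addr0.
have -> : t + 2 * pi * k.+1%:R = t + 2 * pi * k%:R + pi *+ 2.
  by rewrite -natr1 -mulr_natl; ring.
by rewrite /expi cosD2pi sinD2pi -/(expi _) IHk.
Qed.

(** [acos] yields an angle in [0, pi] with the right cosine and a nonnegative sine, hence the split
    on the sign of [b]. *)
Lemma expi_surj z : `|z| = 1 -> exists2 t, 0 <= t < 2 * pi & expi t = z.
Proof.
case: z => a b nz.
have ab1 : a ^+ 2 + b ^+ 2 = 1.
  by apply: (@complexI R); rewrite (add_Re2_Im2 (a +i* b)%C) nz expr1n.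
have a1 : -1 <= a <= 1 by apply/andP; split; nra.
have aitv : a \in `[(-1), 1] by rewrite in_itv.
have pi0 := pi_gt0 R.
have := acos_ge0 a1; have := acos_lepi a1 => le_pi ge0.
have sinE : sin (acos a) = `|b|.
  by rewrite sin_acos// -sqrtr_sqr; congr Num.sqrt; lra.
have [b0|b0] := leP 0 b.
  exists (acos a); first by apply/andP; split; lra.
  by rewrite /expi acosK// sinE ger0_norm.
(* Since [b < 0] excludes [a = 1], [acos a] is positive and this angle stays strictly below 2 pi. *)
exists (- acos a + pi *+ 2).
  have : 0 < acos a by apply: acos_gt0; apply/andP; split; nra.
  by rewrite -mulr_natl => ?; apply/andP; split; lra.
by rewrite /expi cosD2pi sinD2pi cosN sinN acosK// sinE ltr0_norm// opprK.
Qed.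

(** By the half-angle formula, cosine 1 at [t] forces [sin (t / 2) = 0], whereas sine is positive
    strictly between 0 and pi. *)
Lemma expi_eq1 t : 0 <= t < 2 * pi -> expi t = 1 -> t = 0.
Proof.
move=> /andP[t0 t2pi] [cos1 _].
have sin0 : sin (t / 2) = 0.
  have := cos_mulr2n (t / 2); have -> : (t / 2) *+ 2 = t by lra.
  rewrite cos1 => /= h; have := cos2Dsin2 (t / 2).
  by move=> h'; apply/eqP; rewrite -sqrf_eq0; apply/eqP; lra.
have [//|tn0] := eqVneq t 0.
have : 0 < sin (t / 2).
  have {tn0} t_gt0 : 0 < t by rewrite lt_neqAle eq_sym tn0.
  by apply: sin_gt0_pi; apply/andP; split; lra.
by rewrite sin0 ltxx.
Qed.

Lemma expi_inj (s t : R) : 0 <= s < 2 * pi -> 0 <= t < 2 * pi ->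
  expi s = expi t -> s = t.
Proof.
wlog st : s t / s <= t => [hw hs ht e|/andP[s0 s2] /andP[t0 t2] e].
  by have [st|/ltW ts] := leP s t; [exact: hw|apply/esym/hw].
apply/eqP; rewrite eq_sym -subr_eq0; apply/eqP/expi_eq1.
  by apply/andP; split; lra.
by rewrite expiD -e mulrC expiN.
Qed.

(* The solutions are [(t0 + 2 pi k) / 4] for [k < 4], with [t0] the argument
   of [z]. *)
Lemma card_expi_mul4 z : `|z| = 1 ->
  ([set t : R | 0 <= t < 2 * pi /\ expi (4 * t) = z] #= `I_4)%card.
Proof.
move=> /expi_surj[t0 /andP[t0_ge0 t0_lt] t0z].
have pi0 := pi_gt0 R.
pose f (k : nat) : R := (t0 + 2 * pi * k%:R) / 4.
suff -> : [set t : R | 0 <= t < 2 * pi /\ expi (4 * t) = z] = f @` `I_4.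
  apply: inj_card_eq => j k _ _; rewrite /f => e.
  by apply/eqP; rewrite -(eqr_nat R); apply/eqP; nra.
apply/seteqP; split => [t [/andP[t_ge0 t_lt] tz]|_ [k /= k4 <-]]; last first.
  have k3 : k%:R <= 3 :> R by rewrite (ler_nat R k 3).
  have k0 : 0 <= k%:R :> R by [].
  split; first by rewrite /f; apply/andP; split; nra.
  by rewrite -t0z -(expi_add2pi t0 k); congr expi; rewrite /f; field.
(* [k] counts the full turns in [4 * t]; the remainder lies in [0, 2 pi), where injectivity of
   [expi] identifies it with [t0]. *)
pose x := 4 * t / (2 * pi); pose k := Num.truncn x.
have xE : 4 * t = 2 * pi * x by rewrite [RHS]mulrC divfK// lt0r_neq0//; lra.
have x0 : 0 <= x by rewrite /x divr_ge0//; lra.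
have x4 : x < 4%:R by nra.
have /andP[kx xk] := truncn_itv x0; rewrite -/k -natr1 in kx xk.
exists k; first by rewrite /= truncn_lt_nat.
suff : 4 * t - 2 * pi * k%:R = t0 by rewrite /f; lra.
apply: expi_inj; [by apply/andP; split; nra|by apply/andP|].
by rewrite -(expi_add2pi _ k) subrK tz.
Qed.

End Expi.

(** * Tensors in the plane under rotations and the swap *)

Section PlaneTensors.
Set Implicit Arguments.
Unset Strict Implicit.
Variable R : realType.
Implicit Types (G : tensor R 2) (s : 'M[R]_2) (t : R).

Lemma ord2P (P : 'I_2 -> Prop) : P ix1 -> P ix2 -> forall i, P i.
Proof.
move=> P1 P2 [[|[|//]] lti].
  by rewrite (_ : Ordinal _ = ix1)//; exact: val_inj.
by rewrite (_ : Ordinal _ = ix2)//; exact: val_inj.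
Qed.

Lemma sum_ord2 (V : zmodType) (F : 'I_2 -> V) :
  \sum_(i < 2) F i = F ix1 + F ix2.
Proof.
by rewrite big_ord_recl big_ord1; congr (_ + F _); exact: val_inj.
Qed.

Lemma rev_ix1 : rev_ord ix1 = ix2. Proof. exact: val_inj. Qed.

Lemma rev_ix2 : rev_ord ix2 = ix1. Proof. exact: val_inj. Qed.

Lemma trilinear_ord2 G : trilinear G ->
  [/\ G ix1 ix1 ix2 = G ix2 ix1 ix1, G ix1 ix2 ix1 = G ix2 ix1 ix1,
      G ix2 ix1 ix2 = G ix1 ix2 ix2 & G ix2 ix2 ix1 = G ix1 ix2 ix2].
Proof.
move=> Gt; have [e1 _] := Gt ix1 ix1 ix2; have [_ e2] := Gt ix1 ix2 ix1.
have [_ e3] := Gt ix2 ix1 ix2; have [e4 _] := Gt ix2 ix2 ix1.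
by rewrite e1 e2 e4 e3.
Qed.

Lemma tensor_actE s G i j k : tensor_act s G i j k =
  \sum_(i' < 2) \sum_(j' < 2) \sum_(k' < 2)
    s i i' * s j j' * s k k' * G i' j' k'.
Proof. by rewrite ffunE mxE. Qed.

Lemma tensor_act_mul (s s' : 'M[R]_2) G :
  tensor_act (s *m s') G = tensor_act s (tensor_act s' G).
Proof.
apply/ffunP => i; apply/matrixP => j k.
rewrite !tensor_actE !sum_ord2 !tensor_actE !sum_ord2 !mxE !sum_ord2.
by ring.
Qed.

Lemma trilinear_act s G : trilinear G -> trilinear (tensor_act s G).
Proof.
move=> Gt i j k; rewrite !tensor_actE !sum_ord2.
have [e1 e2 e3 e4] := trilinear_ord2 Gt.
by rewrite e1 e2 e3 e4; split; ring.
Qed.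

(** The vector of traces over the lower indices, its second component taken as real part: in this
    order a rotation by t acts as e^{-it} rather than e^{it}. *)
Definition trace_part G : R[i] :=
  ((G ix2 ix2 ix2 + G ix2 ix1 ix1) +i* (G ix1 ix2 ix2 + G ix1 ix1 ix1))%C.

(** For symmetric [G] this is i f(1, i), with f the cubic form of [G]. The vector (1, i) is an
    eigenvector of every rotation, whence the factor e^{3it}. *)
Definition harmonic_part G : R[i] :=
  ((G ix2 ix2 ix2 - 3 * G ix2 ix1 ix1)
   +i* (G ix1 ix1 ix1 - 3 * G ix1 ix2 ix2))%C.

(** This is [Theta] for [G] and [Psi] for the swapped tensor, so one study of rotations serves both
    families. *)
Definition decoupling_angles G : set R := [set t : R | 0 <= t < 2 * pi /\
  expi (4 * t) = trace_part G / harmonic_part G].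

Lemma trace_part_rotation t G : trilinear G ->
  trace_part (tensor_act (rotation t) G) = expi (- t) * trace_part G.
Proof.
move=> Gt.
have [e1 e2 e3 e4] := trilinear_ord2 Gt.
rewrite /trace_part !tensor_actE !sum_ord2 !mxE /= e1 e2 e3 e4.
apply: complex_eqP; rewrite /= cosN sinN.
  (* The left side is cubic in [cos t] and [sin t], the right side linear; the inserted sum of
     squares equalises the degrees. *)
  by rewrite -[RHS]mul1r -(cos2Dsin2 t); ring.
by rewrite -[RHS]mul1r -(cos2Dsin2 t); ring.
Qed.

Lemma harmonic_part_rotation t G : trilinear G ->
  harmonic_part (tensor_act (rotation t) G) = expi t ^+ 3 * harmonic_part G.
Proof.
move=> Gt.
have [e1 e2 e3 e4] := trilinear_ord2 Gt.
rewrite /harmonic_part !tensor_actE !sum_ord2 !mxE /= e1 e2 e3 e4.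
rewrite !exprS expr0 mulr1.
by apply: complex_eqP; rewrite /=; ring.
Qed.

Lemma tensor_act_swap G i j k :
  tensor_act swap_mx G i j k = G (rev_ord i) (rev_ord j) (rev_ord k).
Proof.
rewrite tensor_actE !sum_ord2 !mxE /=.
by move: i j k; do 3![apply: ord2P]; rewrite ?rev_ix1 ?rev_ix2 /=; ring.
Qed.

Lemma trace_part_swap G : trace_part (tensor_act swap_mx G) =
  ((G ix1 ix1 ix1 + G ix1 ix2 ix2) +i* (G ix2 ix1 ix1 + G ix2 ix2 ix2))%C.
Proof.
by rewrite /trace_part !tensor_act_swap rev_ix1 rev_ix2.
Qed.

Lemma harmonic_part_swap G : harmonic_part (tensor_act swap_mx G) =
  ((G ix1 ix1 ix1 - 3 * G ix1 ix2 ix2)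
   +i* (G ix2 ix2 ix2 - 3 * G ix2 ix1 ix1))%C.
Proof.
by rewrite /harmonic_part !tensor_act_swap rev_ix1 rev_ix2.
Qed.

(** The two parts differ by 4 (a_2 + i a_1), and by symmetry a_1 and a_2 are the only off-diagonal
    coefficients. *)
Lemma fully_decoupledP G : trilinear G ->
  fully_decoupled G <-> trace_part G = harmonic_part G.
Proof.
move=> Gt; split=> [Gd|[re im]].
  rewrite /trace_part /harmonic_part (Gd ix2 ix1 ix1)// (Gd ix1 ix2 ix2)//.
  by rewrite mulr0 add0r addr0 !subr0.
have [e1 e2 e3 e4] := trilinear_ord2 Gt.
have a2 : G ix2 ix1 ix1 = 0 by lra.
have a1 : G ix1 ix2 ix2 = 0 by lra.
by do 3![apply: ord2P] => // _; rewrite ?(e1, e2, e3, e4).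
Qed.

Lemma fully_decoupled_trace G : fully_decoupled G ->
  (G ix2 ix2 ix2 +i* G ix1 ix1 ix1)%C = trace_part G.
Proof.
move=> Gd; rewrite /trace_part (Gd ix2 ix1 ix1)// (Gd ix1 ix2 ix2)//.
by rewrite addr0 add0r.
Qed.

(** Multiply e^{-it} u = e^{3it} w by e^{it}. The product form also makes sense before w is known to
    be nonzero. *)
Lemma fully_decoupled_rotation t G : trilinear G ->
  fully_decoupled (tensor_act (rotation t) G) <->
  expi (4 * t) * harmonic_part G = trace_part G.
Proof.
move=> Gt; rewrite (fully_decoupledP (trilinear_act _ Gt)).
rewrite trace_part_rotation// harmonic_part_rotation// expi_mul4.
split=> [e|<-]; last by rewrite (exprS _ 3) -(mulrA (expi t)) mulrA expiN mul1r.
by rewrite (exprS _ 3) -mulrA -e mulrA [expi t * _]mulrC expiN mul1r.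
Qed.

(** |u|^2 - |w|^2 = 8 (a_1 (a_3 - a_1) - a_2 (a_2 - a_0)). *)
Lemma norm_trace_harmonic G :
  `|trace_part G| = `|harmonic_part G| <->
  G ix2 ix1 ix1 * (G ix2 ix1 ix1 - G ix2 ix2 ix2) =
  G ix1 ix2 ix2 * (G ix1 ix1 ix1 - G ix1 ix2 ix2).
Proof.
split=> [e|e].
  have := congr1 (fun x => x ^+ 2) e; rewrite -!add_Re2_Im2 => /complexI /=.
  by move=> h; nra.
by rewrite !normc_def; congr (Num.sqrt _)%:C%C; rewrite /=; nra.
Qed.

(** If w vanished, so would u, and together they determine all four coefficients. This makes the
    quotient u / w genuine. *)
Lemma harmonic_part_neq0 G : trilinear G -> G <> 0 ->
  `|trace_part G| = `|harmonic_part G| -> harmonic_part G != 0.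
Proof.
move=> Gt Gn0 e; apply/eqP => w0; apply: Gn0.
have u0 : trace_part G = 0 by apply/eqP; rewrite -normr_eq0 e w0 normr0.
have [e1 e2 e3 e4] := trilinear_ord2 Gt.
case: u0 w0 => ua ub [wa wb].
have a0 : G ix2 ix2 ix2 = 0 by lra.
have a1 : G ix1 ix2 ix2 = 0 by lra.
have a2 : G ix2 ix1 ix1 = 0 by lra.
have a3 : G ix1 ix1 ix1 = 0 by lra.
apply/ffunP => i; apply/matrixP => j k; rewrite ffunE mxE.
by move: i j k; do 3![apply: ord2P]; rewrite ?(e1, e2, e3, e4).
Qed.

Lemma decoupling_angles_decouple G t :
  trilinear G -> harmonic_part G != 0 -> decoupling_angles G t ->
  fully_decoupled (tensor_act (rotation t) G) /\
  (tensor_act (rotation t) G ix2 ix2 ix2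
   +i* tensor_act (rotation t) G ix1 ix1 ix1)%C = expi (- t) * trace_part G.
Proof.
move=> Gt w0 [_ et].
have Gd : fully_decoupled (tensor_act (rotation t) G).
  by apply/fully_decoupled_rotation; rewrite // et divfK.
by split=> //; rewrite fully_decoupled_trace// trace_part_rotation.
Qed.

Lemma card_decoupling_angles G : harmonic_part G != 0 ->
  `|trace_part G| = `|harmonic_part G| -> (decoupling_angles G #= `I_4)%card.
Proof.
move=> w0 e; apply: card_expi_mul4.
by rewrite normrM normfV e divff// normr_eq0.
Qed.

(** * The orthogonal group of the plane *)

Lemma orthogonal_rotation t : orthogonal_mx (rotation t).
Proof.
have e := cos2Dsin2 t.
by apply/matrixP; do 2![apply: ord2P]; rewrite !mxE sum_ord2 !mxE /=;
  rewrite ?mulr1n ?mulr0n; lra.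
Qed.

Lemma orthogonal_mx2P s : orthogonal_mx s ->
  exists2 t, 0 <= t < 2 * pi & s = rotation t \/ s = rotation t *m swap_mx.
Proof.
move=> /matrixP so.
have := so ix1 ix1; have := so ix1 ix2; have := so ix2 ix2.
rewrite !mxE !sum_ord2 !mxE /=.
set a := s ix1 ix1; set b := s ix1 ix2; set c := s ix2 ix1; set d := s ix2 ix2.
rewrite mulr1n mulr0n => cd ac ab.
have unit (x y : R) : x ^+ 2 + y ^+ 2 = 1 ->
    exists2 t, 0 <= t < 2 * pi & expi t = (x +i* y)%C.
  by move=> xy; apply: expi_surj; rewrite normc_def /= xy sqrtr1.
(* Lagrange's identity: for orthonormal rows the determinant squares to 1. *)
have : (a * d - b * c - 1) * (a * d - b * c + 1) = 0.
  have -> : (a * d - b * c - 1) * (a * d - b * c + 1)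
    = (a * a + b * b) * (c * c + d * d) - (a * c + b * d) ^+ 2 - 1 by ring.
  by rewrite ab cd ac; ring.
move=> /eqP; rewrite mulf_eq0 subr_eq0 addr_eq0.
case/orP=> /eqP det.
  (* The first row, the determinant and orthogonality of the rows determine the second row
     linearly. *)
  have dE : d = a.
    have -> : d = a * (a * d - b * c) + b * (a * c + b * d)
      + (1 - (a * a + b * b)) * d by ring.
    by rewrite det ab ac; ring.
  have cE : c = - b.
    have -> : c = a * (a * c + b * d) - b * (a * d - b * c)
      + (1 - (a * a + b * b)) * c by ring.
    by rewrite det ab ac; ring.
  have [t tpi [ta tb]] := unit a (- b) ltac:(nra).
  exists t => //; left; apply/matrixP.
  by do 2![apply: ord2P]; rewrite mxE /= ?ta ?tb ?opprK.
have dE : d = - a.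
  have -> : d = a * (a * d - b * c) + b * (a * c + b * d)
    + (1 - (a * a + b * b)) * d by ring.
  by rewrite det ab ac; ring.
have cE : c = b.
  have -> : c = a * (a * c + b * d) - b * (a * d - b * c)
    + (1 - (a * a + b * b)) * c by ring.
  by rewrite det ab ac; ring.
(* The first row of [rotation t *m swap_mx] is (- sin t, cos t). *)
have [t tpi [ta tb]] := unit b (- a) ltac:(nra).
exists t => //; right; apply/matrixP.
by do 2![apply: ord2P]; rewrite mxE sum_ord2 !mxE /= ?ta ?tb;
  rewrite mulr0 mulr1 ?addr0 ?add0r ?opprK.
Qed.

End PlaneTensors.

(** * Decoupling criterion and list of all decoupling maps *)

Theorem proposition2p5 (R : realType) (G : tensor R 2)
    (G_neq0 : G <> 0) (G_tri : trilinear G) :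
  let a3 := G ix1 ix1 ix1 in
  let a2 := G ix2 ix1 ix1 in
  let a1 := G ix1 ix2 ix2 in
  let a0 := G ix2 ix2 ix2 in
  let relation := a2 * (a2 - a0) = a1 * (a3 - a1) in
  let Theta : set R := [set t : R | 0 <= t < 2 * pi /\
    expi (4 * t) = ((a0 + a2) +i* (a1 + a3))%C
                   / ((a0 - 3 * a2) +i* (a3 - 3 * a1))%C] in
  let Psi : set R := [set p : R | 0 <= p < 2 * pi /\
    expi (4 * p) = ((a3 + a1) +i* (a2 + a0))%C
                   / ((a3 - 3 * a1) +i* (a0 - 3 * a2))%C] in
  (fully_decoupleable G <-> relation) /\
  (relation ->
    [/\ forall t, Theta t ->
          let RG := tensor_act (rotation t) G in
          fully_decoupled RG /\
          (RG ix2 ix2 ix2 +i* RG ix1 ix1 ix1)%C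
            = expi (- t) * ((a0 + a2) +i* (a1 + a3))%C,
        forall p, Psi p ->
          let SG := tensor_act (rotation p *m swap_mx) G in
          fully_decoupled SG /\
          (SG ix2 ix2 ix2 +i* SG ix1 ix1 ix1)%C
            = expi (- p) * ((a3 + a1) +i* (a0 + a2))%C,
        (Theta #= `I_4)%card,
        (Psi #= `I_4)%card &
        forall s : 'M[R]_2, orthogonal_mx s ->
          fully_decoupled (tensor_act s G) ->
          (exists2 t, Theta t & s = rotation t) \/
          (exists2 p, Psi p & s = rotation p *m swap_mx)]).
Proof.
move=> a3 a2 a1 a0 relation Theta Psi.
pose H := tensor_act swap_mx G.
have H_tri : trilinear H by exact: trilinear_act.
have ThetaE : Theta = decoupling_angles G by [].
have PsiE : Psi = decoupling_angles H.
  by rewrite /decoupling_angles trace_part_swap harmonic_part_swap.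
have normG : relation <-> `|trace_part G| = `|harmonic_part G|.
  by split=> /norm_trace_harmonic.
(* The swap exchanges a_0 with a_3 and a_1 with a_2, which only negates and interchanges the two
   sides of the relation. *)
have normH : relation <-> `|trace_part H| = `|harmonic_part H|.
  rewrite norm_trace_harmonic !tensor_act_swap rev_ix1 rev_ix2.
  by rewrite /relation /a0 /a1 /a2 /a3; split=> e; lra.
have H_neq0 : H <> 0.
  move=> H0; apply: G_neq0; apply/ffunP => i; apply/matrixP => j k.
  rewrite -(rev_ordK i) -(rev_ordK j) -(rev_ordK k) -tensor_act_swap -/H H0.
  by rewrite !ffunE !mxE.
have norm_of_angle (K : tensor R 2) t : trilinear K ->
    fully_decoupled (tensor_act (rotation t) K) ->
    `|trace_part K| = `|harmonic_part K|.
  move=> K_tri /fully_decoupled_rotation - /(_ K_tri) <-.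
  by rewrite normrM norm_expi mul1r.
split.
  split=> [[s [/orthogonal_mx2P[t _ [->|->]]]]|rel].
  - by move=> /norm_of_angle e; apply/normG/e.
  - by rewrite tensor_act_mul => /norm_of_angle e; apply/normH/e.
  have w0 := harmonic_part_neq0 G_tri G_neq0 (normG.1 rel).
  have /expi_surj[t _ et] : `|trace_part G / harmonic_part G| = 1.
    by rewrite normrM normfV (normG.1 rel) divff// normr_eq0.
  (* A quarter of the argument of u / w solves e^{4it} w = u. *)
  exists (rotation (t / 4)); split; first exact: orthogonal_rotation.
  apply/fully_decoupled_rotation => //.
  by rewrite mulrCA divff// mulr1 et divfK.
move=> rel.
have wG := harmonic_part_neq0 G_tri G_neq0 (normG.1 rel).
have wH := harmonic_part_neq0 H_tri H_neq0 (normH.1 rel).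
split.
- by move=> t Tt; exact: decoupling_angles_decouple.
- rewrite PsiE => p Pp /=; rewrite tensor_act_mul.
  have [? ->] := decoupling_angles_decouple H_tri wH Pp.
  by rewrite trace_part_swap [a0 + a2]addrC.
- by rewrite ThetaE; apply: card_decoupling_angles => //; apply/normG.
- by rewrite PsiE; apply: card_decoupling_angles => //; apply/normH.
move=> s /orthogonal_mx2P[t tpi [->|->]].
  (* Dividing e^{4it} w = u by the nonzero w puts the angle in [Theta]; the reflection case does the
     same for [H]. *)
  move=> /fully_decoupled_rotation - /(_ G_tri) et; left; exists t => //.
  by split=> //; rewrite -/(trace_part G) -et mulfK.
rewrite tensor_act_mul => /fully_decoupled_rotation - /(_ H_tri) et.
by right; exists t => //; rewrite PsiE; split=> //; rewrite -et mulfK.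
Qed.
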